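(* Let $\kappa=[2\ell]$ for some $\ell\in\mathbb Z$, let $t=F+\check E+\kappa K^{-1}\in\mathbf U$, and define for $a\ge0$ $$\dot t^{(2a)}=\frac{1}{[2a]!}\prod_{j=-a+1}^{a}\bigl(t-[2j-1]\bigr),\qquad \dot t^{(2a+1)}=\frac{t}{[2a+1]!}\prod_{j=-a+1}^{a}\bigl(t-[2j-1]\bigr).$$ Then for every $m\ge 0$, in $\mathbf U$, $$\dot t^{(2m)}=\sum_{b=0}^{2m}\sum_{a=0}^{b}\sum_{c\ge0} q^{\binom{2c}{2}-b(2m-b-2c)-a(b-a)}\,p^{(2m-b-2c)}(\kappa)\;\check E^{(a)}\Bigl\{\begin{matrix}h;1-m\\ c\end{matrix}\Bigr\}K^{b-2m+2c}F^{(b-a)},$$ $$\dot t^{(2m+1)}=\sum_{b=0}^{2m+1}\sum_{a=0}^{b}\sum_{c\ge0} q^{\binom{2c}{2}-2c-b(2m-b-2c+1)-a(b-a)}\,p^{(2m-b-2c+1)}(\kappa)\;\check E^{(a)}\Bigl\{\begin{matrix}h;1-m\\ c\end{matrix}\Bigr\}K^{b-2m+2c-1}F^{(b-a)}.$$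
   Context: $q$ is an indeterminate, $[n]=\frac{q^n-q^{-n}}{q-q^{-1}}$ for $n\in\mathbb Z$, $[n]!=[1]\cdots[n]$, $[0]!=1$. $\mathbf U$ is the $\mathbb Q(q)$-algebra generated by $E,F,K^{\pm1}$ with relations $KK^{-1}=K^{-1}K=1$, $EF-FE=\frac{K-K^{-1}}{q-q^{-1}}$, $KE=q^2EK$, $KF=q^{-2}FK$. Put $\check E=q^{-1}EK^{-1}$, $\check E^{(n)}=\check E^n/[n]!$, $F^{(n)}=F^n/[n]!$. For $a\in\mathbb Z$, $n\in\mathbb N$: $\Bigl\{\begin{matrix}h;a\\ n\end{matrix}\Bigr\}=\prod_{i=1}^{n}\frac{q^{4a+4i-4}K^{-2}-q^2}{q^{4i}-1}$ (equal to $1$ for $n=0$). The polynomials $p_n(x)$ are defined by $p_0=1$, $p_n=0$ for $n<0$, $p_{n+1}=x\,p_n+q^{1-2n}[n][n-1]p_{n-1}$ ($n\ge0$); $p^{(n)}=p_n/[n]!$ for $n\ge0$ and $p^{(n)}=0$ for $n<0$. *)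

(* Defs.v *)
From HB Require Import structures.
From mathcomp Require Import all_boot all_order all_algebra.
Set Implicit Arguments. Unset Strict Implicit. Unset Printing Implicit Defensive.
Import Order.TTheory GRing.Theory Num.Theory.
Local Open Scope ring_scope.

Definition QQq : fieldType := {fraction {poly rat}}.
Definition qq : QQq := FracField.tofrac ('X : {poly rat}).

Definition qint (n : int) : QQq := (qq ^ n - qq ^ (- n)) / (qq - qq^-1).
Definition qfact (n : nat) : QQq := \prod_(i < n) qint (i.+1)%:Z.

(* ppair x n = (p_n(x), p_{n+1}(x)) with
   p_0 = 1, p_{-1} = 0, p_{n+1} = x p_n + q^{1-2n} [n][n-1] p_{n-1}. *)
Fixpoint ppair (x : QQq) (n : nat) : QQq * QQq :=
  match n with
  | 0 => (1, x)
  | n'.+1 => let (a, b) := ppair x n' in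
             (b, x * b + qq ^ (1 - 2 * n%:Z) * qint n%:Z * qint (n%:Z - 1) * a)
  end.
Definition pn (x : QQq) (n : nat) : QQq := (ppair x n).1.
Definition p_div (x : QQq) (n : int) : QQq :=
  match n with Posz k => pn x k / qfact k | Negz _ => 0 end.

Section Uops.
Variable A : algType QQq.
Variables E F K Ki : A.

Definition U_relations : Prop :=
  [/\ K * Ki = 1, Ki * K = 1,
      E * F - F * E = (qq - qq^-1)^-1 *: (K - Ki),
      K * E = qq ^+ 2 *: (E * K) & K * F = (qq ^ (-2)) *: (F * K)].

Definition Kpow (z : int) : A :=
  match z with Posz n => K ^+ n | Negz n => Ki ^+ n.+1 end.

Definition Echeck : A := qq^-1 *: (E * Ki).
Definition Echeck_div (n : nat) : A := (qfact n)^-1 *: Echeck ^+ n.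
Definition F_div (n : nat) : A := (qfact n)^-1 *: F ^+ n.

Definition hbrace (a : int) (n : nat) : A :=
  \prod_(0 <= i < n)
    ((qq ^ (4 * i.+1%:Z) - 1)^-1 *:
       (qq ^ (4 * a + 4 * i.+1%:Z - 4) *: Ki ^+ 2 - (qq ^+ 2)%:A)).

Definition t_el (kappa : QQq) : A := F + Echeck + kappa *: Ki.

(* prod_{j=-a+1}^{a} (t - [2j-1]) ; index i in [0,2a) corresponds to j = i - a + 1 *)
Definition tprod (kappa : QQq) (a : nat) : A :=
  \prod_(0 <= i < 2 * a) (t_el kappa - (qint (2 * (i%:Z - a%:Z + 1) - 1))%:A).

Definition tdot_even (kappa : QQq) (a : nat) : A :=
  (qfact (2 * a))^-1 *: tprod kappa a.
Definition tdot_odd (kappa : QQq) (a : nat) : A :=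
  (qfact (2 * a).+1)^-1 *: (t_el kappa * tprod kappa a).

End Uops.

(* Main.v *)
Require Import Defs.
From HB Require Import structures.
From mathcomp Require Import all_boot all_order all_algebra.
From mathcomp Require Import ring zify.
Set Implicit Arguments. Unset Strict Implicit. Unset Printing Implicit Defensive.
Import Order.TTheory GRing.Theory Num.Theory.
Local Open Scope ring_scope.

(** Since every power of K occurring with a nonzero coefficient is nonpositive,
    both sides are sums of Echeck^(a) P(K^-1) F^(d) with P a polynomial.
    Straightening t times such a sum gives the new coefficient of
    Echeck^(a) _ F^(d) in terms of those at (a-1,d), (a,d), (a,d-1) and (a+1,d).
    The defining products give t tdot^(2m) = [2m+1] tdot^(2m+1) and
    t tdot^(2m+1) = [2m+2] tdot^(2m+2) + [2m+1] tdot^(2m), so it is enough to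
    check that the claimed coefficients satisfy the same two recursions.  The
    three-term recursion of p_n eliminates kappa; comparing the coefficients of
    p^(n)(kappa) K^-n and factoring out the common brace {h;1-m;c-1}, what is left
    is affine in K^-2, i.e. two identities of rational functions in q^a, q^d,
    q^n, q^c. *)

(** * Rational function identities behind the two recursions *)

(** At x = q^n this is [n]. Treating q^n as a free variable turns identities between q-integers into
    identities of rational functions. *)
Definition bracket (R : fieldType) (q x : R) := (x - x^-1) / (q - q^-1).

Lemma subV_neq0 (R : fieldType) (q : R) : q != 0 -> q ^+ 2 - 1 != 0 -> q - q^-1 != 0.
Proof.
move=> q0; apply: contraNneq => h.
have -> : q ^+ 2 - 1 = q * (q - q^-1) by field.
by rewrite h mulr0.
Qed.

Section ScalarIdentities.
Variables (R : fieldType) (q A D X Y : R).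
Hypotheses (q0 : q != 0) (A0 : A != 0) (D0 : D != 0) (X0 : X != 0) (Y0 : Y != 0).
Hypotheses (q2 : q ^+ 2 - 1 != 0) (Y4 : Y ^+ 4 - 1 != 0).

(* These are the weights in the recursion for the coefficient of
   Echeck^(a) _ F^(d), at A = q^a, D = q^d, X = q^n, Y = q^c, for the braces
   {h;1-m;c} (same), its shift under K |-> q^2 K (shift), and {h;1-m;c-1} (prev). *)
Definition same_coef := bracket q A * D * X + D / A * bracket q X.
Definition shift_coef := bracket q D / A / X.
Definition prev_coefX2 :=
  (D * X * A ^+ 3)^-1 / (q ^+ 2 - 1) - bracket q X / (A ^+ 3 * D * q * X ^+ 2).
Definition prev_coef1 := - (A * D * X)^-1 / (q ^+ 2 - 1).

Let nz := (subV_neq0 q0 q2, q0, A0, D0, X0, Y0, q2, Y4).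

(** The case c = 0 of both recursions, where all braces are 1. *)
Lemma bracket_split : same_coef + shift_coef = bracket q (A * D * X).
Proof. by rewrite /same_coef /shift_coef /bracket; field; rewrite !nz. Qed.

(** [M] stands for q^(a+d+n+2c), which is q^(2m+1) in the odd step and q^(2m+2) in the even one. [g]
    is the ratio of the powers q^[twist_exp 0] at c and at c - 1; [g2] below is the same for
    [twist_exp 1]. *)
Let M := A * D * X * Y ^+ 2.
Let g := Y ^+ 4 / q ^+ 3.

(** [Z] is q^(-4m). Over the common brace, {h;1-m;c} has an extra factor with K^-2 coefficient Y^4 Z
    / (Y^4 - 1), and the shifted brace one with Z / (Y^4 - 1); their constant coefficients agree. *)
Lemma odd_step_coefX2 (Z := q ^+ 2 / M ^+ 2) :
  bracket q M * (g / Y ^+ 2) * (Y ^+ 4 * Z / (Y ^+ 4 - 1)) =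
  same_coef * g * (Y ^+ 4 * Z / (Y ^+ 4 - 1)) + shift_coef * g * (Z / (Y ^+ 4 - 1))
  + prev_coefX2.
Proof.
by rewrite /Z /g /M /same_coef /shift_coef /prev_coefX2 /bracket; field; rewrite !nz.
Qed.

Lemma odd_step_coef1 (z := - q ^+ 2 / (Y ^+ 4 - 1)) :
  bracket q M * (g / Y ^+ 2) * z = same_coef * g * z + shift_coef * g * z + prev_coef1.
Proof.
by rewrite /z /g /M /same_coef /shift_coef /prev_coef1 /bracket; field; rewrite !nz.
Qed.

Let g2 := Y ^+ 4 / q ^+ 5.

Lemma even_step_coefX2 (Z := q ^+ 4 / M ^+ 2) :
  bracket q M * (g2 * Y ^+ 2) * (Z / (Y ^+ 4 - 1)) =
  same_coef * g2 * (Y ^+ 4 * Z / (Y ^+ 4 - 1)) + shift_coef * g2 * (Z / (Y ^+ 4 - 1))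
  + prev_coefX2.
Proof.
by rewrite /Z /g2 /M /same_coef /shift_coef /prev_coefX2 /bracket; field; rewrite !nz.
Qed.

(** tdot^(2m) enters at index c - 1, hence as the common brace itself, and so contributes to the
    constant coefficient only. Here M / q is q^(2m+1). *)
Lemma even_step_coef1 (z := - q ^+ 2 / (Y ^+ 4 - 1)) :
  bracket q M * (g2 * Y ^+ 2) * z + bracket q (M / q) * (Y ^+ 2 / q ^+ 2) =
  same_coef * g2 * z + shift_coef * g2 * z + prev_coef1.
Proof.
by rewrite /z /g2 /M /same_coef /shift_coef /prev_coef1 /bracket; field; rewrite !nz.
Qed.
End ScalarIdentities.

Lemma big_shift1 (V : zmodType) (M : nat) (u : nat -> V) :
  u 0%N = 0 -> u M = 0 -> \sum_(0 <= i < M) u i.+1 = \sum_(0 <= i < M) u i.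
Proof.
move=> u0 uM.
have E : \sum_(0 <= i < M.+1) u i = \sum_(0 <= i < M.+1) u i by [].
by move: E; rewrite {1}big_nat_recl // big_nat_recr //= uM u0 addr0 add0r.
Qed.

(** * Powers of q, q-integers and q-factorials *)

Lemma qq_neq0 : qq != 0.
Proof. by rewrite tofrac_eq0 polyX_eq0. Qed.

Lemma qqX_neq1 n : qq ^+ n.+1 - 1 != 0.
Proof.
rewrite -tofracXn -tofrac1 -tofracB tofrac_eq0 -lead_coef_eq0.
by rewrite lead_coefDl ?lead_coefXn ?oner_eq0 // size_polyXn size_polyN size_poly1.
Qed.

Lemma qint_bracket z : qint z = bracket qq (qq ^ z).
Proof. by rewrite /qint /bracket invr_expz. Qed.

Lemma qint0 : qint 0 = 0.
Proof. by rewrite /qint oppr0 subrr mul0r. Qed.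

Lemma qintN z : qint (- z) = - qint z.
Proof. by rewrite /qint opprK -mulNr opprB. Qed.

Lemma qintS_neq0 (n : nat) : qint n.+1 != 0.
Proof.
have h k : qq ^+ k.+1 - (qq ^+ k.+1)^-1 != 0.
  apply: subV_neq0; first by rewrite expf_neq0 // qq_neq0.
  by rewrite -exprM mulnC mulSn addSn qqX_neq1.
rewrite qint_bracket /bracket -exprnP; apply: mulf_neq0; first exact: h.
by rewrite invr_eq0 -[qq]expr1 h.
Qed.

Lemma qfact0 : qfact 0 = 1.
Proof. by rewrite /qfact big_ord0. Qed.

Lemma qfactS n : qfact n.+1 = qfact n * qint n.+1.
Proof. by rewrite /qfact big_ord_recr. Qed.

Lemma qfact_neq0 n : qfact n != 0.
Proof.
elim: n => [|n IH]; first by rewrite /qfact big_ord0 oner_eq0.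
by rewrite qfactS; apply: mulf_neq0 IH (qintS_neq0 n).
Qed.

Local Opaque qq qint qfact.

(** * The polynomials p_n and the braces as polynomials in K^-1 *)

Lemma pn_rec x n :
  pn x n.+2 =
    x * pn x n.+1 + qq ^ (1 - 2 * n.+1%:Z) * qint n.+1 * qint (n.+1%:Z - 1) * pn x n.
Proof.
by rewrite /pn /=; case: (ppair x n).
Qed.

(* [field] does not terminate on the concrete field [QQq], so field identities
   are proved over an abstract field. *)
Lemma divided_two_term (R : fieldType) (x f u : R) :
  f != 0 -> u != 0 -> x * (1 / f) = u * (x / (f * u)).
Proof. by move=> f0 u0; field; rewrite f0 u0. Qed.

Lemma divided_three_term (R : fieldType) (x a b e f u v w : R) :
  f != 0 -> u != 0 -> w != 0 ->
  x * (b / (f * u)) = w * ((x * b + e * u * v * a) / (f * u * w)) - e * v * (a / f).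
Proof. by move=> f0 u0 w0; field; rewrite f0 u0 w0. Qed.

(** For n >= 1 this is the recursion of p_n divided by [n]!. It extends to all integers: at n = 0
    the last term has p^(-1) = 0, and at n = -1 the factor [0] kills p^(0). *)
Lemma p_div_rec x (n : int) :
  x * p_div x n =
    qint (n + 1) * p_div x (n + 1) - qq ^ (1 - 2 * n) * qint (n - 1) * p_div x (n - 1).
Proof.
case: n => [[|n]|[|n]].
- rewrite /= mulr0 subr0 qfactS add0r.
  exact: divided_two_term (qfact_neq0 0) (qintS_neq0 0).
- have -> : n.+1%:Z - 1 = n by lia.
  have -> : n.+1%:Z + 1 = n.+2 by lia.
  rewrite /p_div pn_rec !qfactS.
  have -> : n.+1%:Z - 1 = n by lia.
  exact: divided_three_term (qfact_neq0 n) (qintS_neq0 n) (qintS_neq0 n.+1).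
- by rewrite /= mulr0 (_ : (-1)%Z + 1 = 0) // qint0 mul0r mulr0 subrr.
- have -> : Negz n.+1 + 1 = Negz n by lia.
  have -> : Negz n.+1 - 1 = Negz n.+2 by lia.
  by rewrite /= !mulr0 subrr.
Qed.

(** With 'X standing for K^-1 this is p^(n)(kappa) K^(-n). For n < 0 the scalar is 0, so the
    absolute value in the exponent is harmless. *)
Definition pX (kappa : QQq) (n : int) : {poly QQq} := p_div kappa n *: 'X^`|n|.

Lemma pX0 kappa : pX kappa 0 = 1.
Proof. by rewrite /pX (_ : p_div kappa 0 = 1 / qfact 0) // qfact0 divr1 scale1r. Qed.

Lemma pX_neg kappa n : n < 0 -> pX kappa n = 0.
Proof. by case: n => // n _; rewrite /pX scale0r. Qed.

Lemma pX_rec kappa (n : int) :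
  kappa *: ('X * pX kappa (n - 1)) =
    qint n *: pX kappa n - (qq ^ (3 - 2 * n) * qint (n - 2)) *: ('X^2 * pX kappa (n - 2)).
Proof.
rewrite /pX -!scalerAr !scalerA p_div_rec.
have -> : n - 1 + 1 = n by ring.
have -> : n - 1 - 1 = n - 2 by ring.
have -> : 1 - 2 * (n - 1) = 3 - 2 * n by ring.
rewrite scalerBl -exprS -exprD; congr (_ - _).
  (* The exponents of 'X agree only for n >= 1; otherwise [n] p^(n) = 0. Likewise p^(n-2) = 0 for n
     < 2 below. *)
  have [n1|] := boolP (1 <= n); first by have -> : `|n - 1|.+1 = `|n|%N by lia.
  case: n => [[|n]|n] // _; first by rewrite qint0 mul0r !scale0r.
  by rewrite /= mulr0 !scale0r.
have [n1|] := boolP (2 <= n); first by have -> : `|n - 1|.+1 = (2 + `|n - 2|)%N by lia.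
move=> n2; have n2_lt0 : n - 2 < 0 by lia.
have -> : p_div kappa (n - 2) = 0 by case: (n - 2) n2_lt0.
by rewrite mulr0 !scale0r.
Qed.

(* F P(K^-1) = (P \Po qshift)(K^-1) F *)
Definition qshift : {poly QQq} := qq ^ (-2) *: 'X.

Lemma pX_qshift kappa n : pX kappa n \Po qshift = qq ^ (-2 * n) *: pX kappa n.
Proof.
rewrite /pX /qshift comp_polyZ rmorphXn /= comp_polyX exprZn !scalerA mulrC.
by case: n => [n|n] /=; rewrite ?mulr0 ?mul0r ?scale0r ?absz_nat // exprnP exprz_exp.
Qed.

(** The brace {h;1-m;c}: the exponent 4(1-m) + 4i - 4 equals 4i - 4m. *)
Definition hpoly (m c : nat) : {poly QQq} :=
  \prod_(0 <= i < c)
    ((qq ^ (4 * i.+1%:Z) - 1)^-1 *: (qq ^ (4 * i.+1%:Z - 4 * m%:Z) *: 'X^2 - (qq ^+ 2)%:P)).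

Lemma hpoly0 m : hpoly m 0 = 1.
Proof. by rewrite /hpoly big_geq. Qed.

Lemma hpolySr m c : hpoly m c.+1 =
  hpoly m c *
  ((qq ^ (4 * c.+1%:Z) - 1)^-1 *: (qq ^ (4 * c.+1%:Z - 4 * m%:Z) *: 'X^2 - (qq ^+ 2)%:P)).
Proof. by rewrite /hpoly big_nat_recr. Qed.

(** Raising m by one moves the numerators by one place, so those of [hpoly m c] recur and the new
    one has exponent -4m. The denominators do not involve m. *)
Lemma hpolyS m c : hpoly m.+1 c.+1 =
  hpoly m c *
  ((qq ^ (4 * c.+1%:Z) - 1)^-1 *: (qq ^ (- 4 * m%:Z) *: 'X^2 - (qq ^+ 2)%:P)).
Proof.
elim: c => [|c IH]; rewrite hpolySr.
  rewrite !hpoly0 !mul1r.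
  by have -> : 4 * 1%:Z - 4 * m.+1%:Z = - 4 * m%:Z by lia.
rewrite IH [in RHS]hpolySr -!mulrA; congr (_ * _).
have -> : 4 * c.+2%:Z - 4 * m.+1%:Z = 4 * c.+1%:Z - 4 * m%:Z by lia.
by rewrite -!scalerAl -!scalerAr; congr (_ *: (_ *: _)); exact: mulrC.
Qed.

Lemma hpoly_qshift m c : hpoly m c \Po qshift = hpoly m.+1 c.
Proof.
rewrite /hpoly rmorph_prod /=; apply: eq_bigr => i _.
rewrite comp_polyZ comp_polyB comp_polyZ comp_polyC rmorphXn /= comp_polyX /qshift.
rewrite exprZn scalerA exprnP exprz_exp -expfzDr ?qq_neq0 //.
by have -> : 4 * i.+1%:Z - 4 * m%:Z + -2 * 2 = 4 * i.+1%:Z - 4 * m.+1%:Z by lia.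
Qed.

(* [eps] is 0 for tdot^(2m) and 1 for tdot^(2m+1); the indices a, d of [k_poly]
   are integers so that a - 1 and d - 1 make sense in [act_coef], where the terms at
   -1 are killed by [0] = 0. *)
Definition twist_exp (eps c : nat) : int := 'C(2 * c, 2)%:Z - 2 * (eps * c)%:Z.

Definition coef_deg (eps m : nat) (a d : int) (c : nat) : int :=
  2 * m%:Z + eps%:Z - a - d - 2 * c%:Z.

(** Here b = a + d, and [M] truncates the sum over c; once [M] is large the omitted terms have
    negative degree and vanish. *)
Definition k_poly (kappa : QQq) (M eps m : nat) (a d : int) : {poly QQq} :=
  \sum_(0 <= c < M) qq ^ (twist_exp eps c - (a + d) * coef_deg eps m a d c - a * d) *:
    (hpoly m c * pX kappa (coef_deg eps m a d c)).

(** In order: the contributions of Echeck, of kappa K^-1, of F carried through to the right, and of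
    the correction from straightening F Echeck^(a+1). *)
Definition act_coef (kappa : QQq) (P : int -> int -> {poly QQq}) (a d : int) : {poly QQq} :=
  qint a *: P (a - 1) d + qq ^ (- (2 * a)) *: (kappa *: ('X * P a d))
  + (qq ^ (- (2 * a)) * qint d) *: (P a (d - 1) \Po qshift)
  + (qq ^+ 2 - 1)^-1 *: ((qq ^ (- (3 * a)) *: 'X^2 - (qq ^ (- a))%:P) * P (a + 1) d).

(** * The action of t on the claimed coefficients *)

Lemma qqD (m n : int) : qq ^ (m + n) = qq ^ m * qq ^ n.
Proof. exact: expfzDr qq_neq0. Qed.

Lemma qqN (n : int) : qq ^ (- n) = (qq ^ n)^-1.
Proof. by rewrite invr_expz. Qed.

Lemma qqM (k : nat) (n : int) : qq ^ (k%:Z * n) = (qq ^ n) ^+ k.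
Proof. by rewrite mulrC -exprz_exp. Qed.

Lemma pX_rec_scaled kappa (n : int) (w : QQq) (G : {poly QQq}) :
  kappa *: ('X * (w *: (G * pX kappa (n - 1)))) =
    (w * qint n) *: (G * pX kappa n)
    - (w * (qq ^ (3 - 2 * n) * qint (n - 2))) *: ('X^2 * (G * pX kappa (n - 2))).
Proof.
have E := pX_rec kappa n.
move: (pX kappa n) (pX kappa (n - 1)) (pX kappa (n - 2)) E => p p1 p2 E.
have -> : kappa *: ('X * (w *: (G * p1))) = w *: (G * (kappa *: ('X * p1))).
  by rewrite -!scalerAr mulrCA !scalerA [w * kappa]mulrC.
by rewrite E mulrBr -!scalerAr scalerBr !scalerA (mulrCA G).
Qed.

(** This and the next three lemmas bring the c-th summand of one contribution in [act_coef] to a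
    common form: q^(-(a+d)n - ad) q^[twist_exp] times a weight, a brace and p^(n)(kappa) K^(-n). *)
Lemma act_coef_up kappa eps m (a d : int) c (n : int := coef_deg eps m a d c + 1)
    (A := qq ^ a) (D := qq ^ d) (X := qq ^ n) (G : {poly QQq}) :
  let n' := coef_deg eps m (a - 1) d c in
  qint a *: (qq ^ (twist_exp eps c - (a - 1 + d) * n' - (a - 1) * d) *:
    (G * pX kappa n')) =
  qq ^ (- ((a + d) * n) - a * d) *: (qq ^ twist_exp eps c *:
     ((bracket qq A * D * X) *: (G * pX kappa n))).
Proof.
move=> n'; have -> : n' = n by rewrite /n' /n /coef_deg; ring.
rewrite !scalerA qint_bracket; congr (_ *: _).
have -> : twist_exp eps c - (a - 1 + d) * n - (a - 1) * d =
   - ((a + d) * n) - a * d + (twist_exp eps c + (d + n)) by ring.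
by rewrite 3!qqD -/A -/D -/X; ring.
Qed.

(** The three-term recursion removes kappa and leaves degrees n and n - 2; the second is the degree
    met in [act_coef_prev]. *)
Lemma act_coef_mid kappa eps m (a d : int) c (n : int := coef_deg eps m a d c + 1)
    (A := qq ^ a) (D := qq ^ d) (X := qq ^ n) (G : {poly QQq}) :
  let n' := coef_deg eps m a d c in
  qq ^ (- (2 * a)) *: (kappa *: ('X * (qq ^ (twist_exp eps c - (a + d) * n' - a * d) *:
    (G * pX kappa n')))) =
  qq ^ (- ((a + d) * n) - a * d) *: (qq ^ twist_exp eps c *:
     ((D / A * bracket qq X) *: (G * pX kappa n))) +
  qq ^ (- ((a + d) * (n - 2)) - a * d) *: (qq ^ twist_exp eps c *:
     ((- (bracket qq (qq ^ (n - 2)) / (A ^+ 3 * D * qq * (qq ^ (n - 2)) ^+ 2))) *: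
     ('X^2 * (G * pX kappa (n - 2))))).
Proof.
move=> n'.
have -> : n' = n - 1 by rewrite /n' /n /coef_deg; ring.
rewrite pX_rec_scaled scalerBr !scalerA -scaleNr !qint_bracket -/X.
congr (_ *: _ + _ *: _).
  rewrite [LHS]mulrA -[in LHS]qqD; set e := - (2 * a) + _.
  have -> : e = - ((a + d) * n) - a * d + (twist_exp eps c + (d + - a)) by rewrite /e; ring.
  by rewrite 3!qqD (qqN a) -/A -/D; ring.
rewrite mulrN; congr (- _); rewrite 2![LHS]mulrA -2![in LHS]qqD; set e := _ + (3 - 2 * n).
have -> : e = - ((a + d) * (n - 2)) - a * d + (twist_exp eps c +
      - (3%:Z * a + (d + (1 + 2%:Z * (n - 2))))) by rewrite /e; ring.
rewrite (qqD (_ - a * d)) (qqD (twist_exp _ _)) (qqN (3%:Z * a + _)) (qqD (3%:Z * a)).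
rewrite (qqD d) (qqD 1) !qqM expr1z -/A -/D !invfM.
by move: (bracket _ _) => b; ring.
Qed.

Lemma act_coef_shift kappa eps m (a d : int) c (n : int := coef_deg eps m a d c + 1)
    (A := qq ^ a) (D := qq ^ d) (X := qq ^ n) :
  let n' := coef_deg eps m a (d - 1) c in
  (qq ^ (- (2 * a)) * qint d) *:
    ((qq ^ (twist_exp eps c - (a + (d - 1)) * n' - a * (d - 1)) *:
    (hpoly m c * pX kappa n')) \Po qshift) =
  qq ^ (- ((a + d) * n) - a * d) *: (qq ^ twist_exp eps c *:
     ((bracket qq D / A / X) *: (hpoly m.+1 c * pX kappa n))).
Proof.
move=> n'; have -> : n' = n by rewrite /n' /n /coef_deg; ring.
rewrite comp_polyZ rmorphM /= hpoly_qshift pX_qshift -scalerAr !scalerA qint_bracket.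
congr (_ *: _).
set b := bracket _ _; set e : int := _ - a * (d - 1).
have -> : qq ^ (- (2 * a)) * b * qq ^ e * qq ^ (-2 * n) =
  qq ^ (- (2 * a) + e + -2 * n) * b by rewrite (qqD _ (-2 * n)) (qqD _ e); ring.
have -> : - (2 * a) + e + -2 * n =
  - ((a + d) * n) - a * d + (twist_exp eps c + - (a + n)) by rewrite /e; ring.
rewrite (qqD (_ - a * d)) (qqD (twist_exp _ _)) (qqN (a + n)) (qqD a n) -/A -/X (invfM A X).
by move: b => b; ring.
Qed.

Lemma scale_binomial_mul (R : comNzRingType) (k u v t w z : R) (H : {poly R}) :
  k *: ((u *: 'X^2 - v%:P) * ((t * (w * z)) *: H)) =
  t *: (w *: (((k * u * z) *: 'X^2 + (- (k * v * z))%:P) * H)).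
Proof. by rewrite -!mul_polyC polyCN !polyCM; ring. Qed.

Lemma act_coef_prev kappa eps m (a d : int) c (n : int := coef_deg eps m a d c - 1)
    (A := qq ^ a) (D := qq ^ d) (X := qq ^ n) (G : {poly QQq}) :
  let n' := coef_deg eps m (a + 1) d c in
  (qq ^+ 2 - 1)^-1 *: ((qq ^ (- (3 * a)) *: 'X^2 - (qq ^ (- a))%:P) *
    (qq ^ (twist_exp eps c - (a + 1 + d) * n' - (a + 1) * d) *: (G * pX kappa n'))) =
  qq ^ (- ((a + d) * n) - a * d) *: (qq ^ twist_exp eps c *:
     ((((D * X * A ^+ 3)^-1 / (qq ^+ 2 - 1)) *: 'X^2 +
       (- (A * D * X)^-1 / (qq ^+ 2 - 1))%:P) * (G * pX kappa n))).
Proof.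
move=> n'; have -> : n' = n by rewrite /n' /n /coef_deg; ring.
move: (G * pX kappa n) => H.
have -> : twist_exp eps c - (a + 1 + d) * n - (a + 1) * d =
    - ((a + d) * n) - a * d + (twist_exp eps c + - (n + d)) by ring.
rewrite (qqD (_ - a * d)) (qqD (twist_exp _ _)) scale_binomial_mul.
rewrite (qqN (n + d)) (qqN a) (qqN (3%:Z * a)) (qqD n d) (qqM 3 a) -/A -/D -/X.
set k := (_ - 1)^-1.
have -> : k / A ^+ 3 / (X * D) = (D * X * A ^+ 3)^-1 * k by rewrite !invfM; ring.
by have -> : - (k / A / (X * D)) = - (A * D * X)^-1 * k by rewrite !invfM; ring.
Qed.

Lemma collect_scaled_terms (R : comNzRingType) (t t' w u1 u2 v s z1 z0 : R)
    (x2 h h' p p' : {poly R}) :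
  t *: (w *: (u1 *: (h * p))) +
  (t *: (w *: (u2 *: (h * p))) + t' *: (w *: (- v *: (x2 * (h * p'))))) +
  t *: (w *: (s *: (h' * p))) + t' *: (w *: ((z1 *: x2 + z0%:P) * (h * p'))) =
  t *: (w *: (((u1 + u2) *: h + s *: h') * p)) +
  t' *: (w *: (((z1 - v) *: x2 + z0%:P) * (h * p'))).
Proof. by rewrite -!mul_polyC !(polyCD, polyCN); ring. Qed.

(** Raising c by one lowers the degree by two, so the lower-degree remainders from index c - 1 have
    the degree of the main terms at index c. At c = 0 there are none. *)
Definition prev_term kappa (eps m : nat) (a d : int) (c : nat) : {poly QQq} :=
  let n := coef_deg eps m a d c + 1 in
  if c is c'.+1 then
    qq ^ twist_exp eps c' *:
      ((prev_coefX2 qq (qq ^ a) (qq ^ d) (qq ^ n) *: 'X^2 +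
        (prev_coef1 qq (qq ^ a) (qq ^ d) (qq ^ n))%:P) * (hpoly m c' * pX kappa n))
  else 0.

Lemma act_coef_k_poly kappa M eps m (a d : int) : coef_deg eps m a d M + 1 < 0 ->
  act_coef kappa (k_poly kappa M eps m) a d =
  \sum_(0 <= c < M) let n := coef_deg eps m a d c + 1 in
    qq ^ (- ((a + d) * n) - a * d) *:
     (qq ^ twist_exp eps c *:
        ((same_coef qq (qq ^ a) (qq ^ d) (qq ^ n) *: hpoly m c +
          shift_coef qq (qq ^ a) (qq ^ d) (qq ^ n) *: hpoly m.+1 c) * pX kappa n) +
      prev_term kappa eps m a d c).
Proof.
move=> degM.
set th := fun c => qq ^ (- ((a + d) * (coef_deg eps m a d c + 1)) - a * d).
have degS c : coef_deg eps m a d c - 1 = coef_deg eps m a d c.+1 + 1.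
  by rewrite /coef_deg; lia.
(* Reindex the remainders; the hypothesis on [M] makes the term at c = M vanish. *)
have split_prev : \sum_(0 <= c < M) th c *: prev_term kappa eps m a d c =
    \sum_(0 <= c < M) th c.+1 *: prev_term kappa eps m a d c.+1.
  rewrite (big_shift1 (u := fun c => th c *: prev_term kappa eps m a d c)) //.
    by rewrite scaler0.
  by rewrite /prev_term; case: (M) degM => [|M'] degM; rewrite ?(pX_neg _ degM) ?mulr0 ?scaler0.
under [RHS]eq_bigr do rewrite /= scalerDr -/(th _).
rewrite big_split /= split_prev -big_split /=.
rewrite /act_coef /k_poly.
rewrite (raddf_sum (comp_poly qshift)) /= !mulr_sumr !scaler_sumr -!big_split /=.
apply: eq_bigr => c _.
rewrite act_coef_up act_coef_mid act_coef_shift act_coef_prev.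
have -> : coef_deg eps m a d c + 1 - 2 = coef_deg eps m a d c.+1 + 1.
  by rewrite -degS; ring.
rewrite degS -/(th c) -/(th c.+1) /=.
rewrite /same_coef /shift_coef /prev_coefX2 /prev_coef1.
set n := coef_deg eps m a d c + 1; set n' := coef_deg eps m a d c.+1 + 1.
exact: collect_scaled_terms.
Qed.

(** * The claimed coefficients satisfy the two recursions *)

Lemma twist_expS eps c :
  twist_exp eps c.+1 = twist_exp eps c + 4 * c%:Z + 1 - 2 * eps%:Z.
Proof.
have binE : 'C(2 * c.+1, 2) = ('C(2 * c, 2) + 4 * c + 1)%N.
  by rewrite mulnS add2n !binS bin1 bin0; lia.
by rewrite /twist_exp binE mulnS; lia.
Qed.

(** Both sides are [H * P] times a polynomial affine in 'X^2, and the two hypotheses compare its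
    coefficients. [H] is the common brace; the [L2] term is that of tdot^(2m) in the even step. *)
Lemma combine_step (R : comNzRingType) (L L2 gl gl2 g r1 r3 x1 x0 k Q u u' ul th t0 : R)
    (H P : {poly R}) :
  let h v := H * (k *: (v *: 'X^2 - Q%:P)) in
  L * gl * (ul * k) = r1 * g * (u * k) + r3 * g * (u' * k) + x1 ->
  L * gl * (- Q * k) + L2 * gl2 = r1 * g * (- Q * k) + r3 * g * (- Q * k) + x0 ->
  L *: ((th * (t0 * gl)) *: (h ul * P)) + L2 *: ((th * (t0 * gl2)) *: (H * P)) =
  th *: ((t0 * g) *: ((r1 *: h u + r3 *: h u') * P)
         + t0 *: ((x1 *: 'X^2 + x0%:P) * (H * P))).
Proof.
move=> h E1 E2.
transitivity (th *: (t0 *: (((L * gl * (ul * k)) *: 'X^2 +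
    (L * gl * (- Q * k) + L2 * gl2)%:P) * (H * P)))).
  by rewrite /h -!mul_polyC !(polyCD, polyCN, polyCM); ring.
by rewrite E1 E2 /h -!mul_polyC !(polyCD, polyCN, polyCM); ring.
Qed.

Lemma qq_expz_neq0 (n : int) : qq ^ n != 0.
Proof. by rewrite expfz_neq0 // qq_neq0. Qed.

Lemma qq4_neq1 c : (qq ^ c.+1%:Z) ^+ 4 - 1 != 0.
Proof. by rewrite -exprnP -exprM mulSn addSn qqX_neq1. Qed.

Section Powers.
Variables (c m : nat).
Let Y := qq ^ c.+1%:Z.

Lemma twist0S : qq ^ twist_exp 0 c.+1 = qq ^ twist_exp 0 c * (Y ^+ 4 / qq ^+ 3).
Proof.
rewrite /Y (exprnP qq) -qqN -qqM -2!qqD twist_expS; congr (_ ^ _); lia.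
Qed.

Lemma twist1S : qq ^ twist_exp 1 c.+1 = qq ^ twist_exp 1 c * (Y ^+ 4 / qq ^+ 5).
Proof.
rewrite /Y (exprnP qq) -qqN -qqM -2!qqD twist_expS; congr (_ ^ _); lia.
Qed.

Lemma twist01 : qq ^ twist_exp 0 c.+1 = qq ^ twist_exp 1 c.+1 * Y ^+ 2.
Proof. rewrite /Y -qqM -qqD; congr (_ ^ _); rewrite /twist_exp; lia. Qed.

Lemma twist01_pred : qq ^ twist_exp 0 c = qq ^ twist_exp 1 c * (Y ^+ 2 / qq ^+ 2).
Proof.
rewrite /Y (exprnP qq) -qqN -qqM -2!qqD; congr (_ ^ _); rewrite /twist_exp; lia.
Qed.

Lemma qqX4 : qq ^ (4 * c.+1%:Z) = Y ^+ 4.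
Proof. exact: (qqM 4). Qed.

Lemma qqX4m : qq ^ (4 * c.+1%:Z - 4 * m%:Z) = Y ^+ 4 * qq ^ (- 4 * m%:Z).
Proof. rewrite /Y -qqM -qqD; congr (_ ^ _); lia. Qed.

Lemma qqm_odd : qq ^ (- 4 * m%:Z) = qq ^+ 2 / (qq ^ (2 * m%:Z + 1)) ^+ 2.
Proof. rewrite (exprnP qq) -qqM -qqN -qqD; congr (_ ^ _); lia. Qed.

Lemma qqm_even : qq ^ (- 4 * m%:Z) = qq ^+ 4 / (qq ^ (2 * m%:Z + 2)) ^+ 2.
Proof. rewrite (exprnP qq) -qqM -qqN -qqD; congr (_ ^ _); lia. Qed.
End Powers.

Lemma odd_step kappa M m (a d : int) : coef_deg 0 m a d M + 1 < 0 ->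
  qint (2 * m%:Z + 1) *: k_poly kappa M 1 m a d = act_coef kappa (k_poly kappa M 0 m) a d.
Proof.
move=> degM; rewrite act_coef_k_poly // /k_poly scaler_sumr.
apply: eq_bigr => c _ /=.
have -> : coef_deg 1 m a d c = coef_deg 0 m a d c + 1 by rewrite /coef_deg; ring.
set n : int := coef_deg 0 m a d c + 1.
have nE : 2 * m%:Z + 1 = a + d + n + 2%:Z * c%:Z by rewrite /n /coef_deg; ring.
have -> : twist_exp 1 c - (a + d) * n - a * d =
  - ((a + d) * n) - a * d + twist_exp 1 c by ring.
rewrite (qqD _ (twist_exp 1 c)).
set th := qq ^ (- ((a + d) * n) - a * d).
have ME : qq ^ (2 * m%:Z + 1) = qq ^ a * qq ^ d * qq ^ n * (qq ^ c%:Z) ^+ 2.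
  by rewrite nE 3!qqD qqM.
(* At c = 0 there is no remainder and [bracket_split] suffices; for positive c the common brace is
   factored out. *)
rewrite /prev_term; case: c @n nE @th ME => [|c] n nE th ME.
  rewrite !hpoly0 /twist_exp /= muln0 mulr0 subr0 expr0z mulr1 scale1r addr0.
  rewrite qint_bracket ME expr0z expr1n mulr1.
  rewrite -(bracket_split qq_neq0 (qq_expz_neq0 a) (qq_expz_neq0 d) (qq_expz_neq0 n) (qqX_neq1 1)).
  set s := same_coef _ _ _ _; set s' := shift_coef _ _ _ _.
  by rewrite -!scalerDl mul1r -!scalerAl !mul1r [LHS]scalerA [RHS]scalerA mulrC.
have -> : qq ^ twist_exp 1 c.+1 =
    qq ^ twist_exp 0 c * (((qq ^ c.+1%:Z) ^+ 4 / qq ^+ 3) / (qq ^ c.+1%:Z) ^+ 2).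
  by rewrite mulrA -twist0S twist01 mulfK // expf_neq0 // qq_expz_neq0.
rewrite twist0S hpolySr hpolyS -/n qqX4m qqX4 (qqm_odd m) qint_bracket ME.
have E1 := odd_step_coefX2 qq_neq0 (qq_expz_neq0 a) (qq_expz_neq0 d) (qq_expz_neq0 n)
  (qq_expz_neq0 c.+1) (qqX_neq1 1) (qq4_neq1 c).
have E2 := odd_step_coef1 qq_neq0 (qq_expz_neq0 a) (qq_expz_neq0 d) (qq_expz_neq0 n)
  (qq_expz_neq0 c.+1) (qqX_neq1 1) (qq4_neq1 c).
(* The odd recursion has a single term on the left, so 0 * 0 fills the slot of [L2]. *)
cbv zeta in E1, E2; rewrite -[LHS]addr0 -[X in _ + X = _](mul0r 0) in E2.
have := combine_step th (qq ^ twist_exp 0 c) (hpoly m c) (pX kappa n) E1 E2.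
by rewrite scale0r addr0.
Qed.

Lemma even_step kappa M m (a d : int) : coef_deg 1 m a d M + 1 < 0 ->
  qint (2 * m%:Z + 2) *: k_poly kappa M 0 m.+1 a d
  + qint (2 * m%:Z + 1) *: k_poly kappa M 0 m a d =
  act_coef kappa (k_poly kappa M 1 m) a d.
Proof.
move=> degM; rewrite act_coef_k_poly // /k_poly !scaler_sumr.
(* The sum for tdot^(2m) with c moved up by one, which matches its degree with that of the main
   terms. *)
pose u c := if c is c'.+1 then qint (2 * m%:Z + 1) *:
   (qq ^ (twist_exp 0 c' - (a + d) * coef_deg 0 m a d c' - a * d) *:
     (hpoly m c' * pX kappa (coef_deg 0 m a d c'))) else 0.
have degS c : coef_deg 0 m a d c = coef_deg 1 m a d c.+1 + 1.
  by rewrite /coef_deg; lia.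
rewrite -[X in _ + X]/(\sum_(0 <= c < M) u c.+1) big_shift1 //; last first.
  rewrite /u; case: (M) degM => // M' degM.
  by rewrite degS (pX_neg _ degM) mulr0 !scaler0.
rewrite -big_split /=; apply: eq_bigr => c _ /=.
have -> : coef_deg 0 m.+1 a d c = coef_deg 1 m a d c + 1 by rewrite /coef_deg; lia.
set n : int := coef_deg 1 m a d c + 1.
have nE : 2 * m%:Z + 2 = a + d + n + 2%:Z * c%:Z by rewrite /n /coef_deg; ring.
have -> : twist_exp 0 c - (a + d) * n - a * d =
  - ((a + d) * n) - a * d + twist_exp 0 c by ring.
rewrite (qqD _ (twist_exp 0 c)).
set th := qq ^ (- ((a + d) * n) - a * d).
have ME : qq ^ (2 * m%:Z + 2) = qq ^ a * qq ^ d * qq ^ n * (qq ^ c%:Z) ^+ 2.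
  by rewrite nE 3!qqD qqM.
have ME1 : qq ^ (2 * m%:Z + 1) = qq ^ a * qq ^ d * qq ^ n * (qq ^ c%:Z) ^+ 2 / qq.
  by rewrite -ME -[X in _ / X]expr1z -qqN -qqD; congr (_ ^ _); ring.
rewrite /prev_term /u; case: c @n nE @th ME ME1 => [|c] n nE th ME ME1.
  rewrite !hpoly0 /twist_exp /= muln0 mulr0 subr0 expr0z mulr1 scale1r !addr0.
  rewrite qint_bracket ME expr0z expr1n mulr1.
  rewrite -(bracket_split qq_neq0 (qq_expz_neq0 a) (qq_expz_neq0 d) (qq_expz_neq0 n) (qqX_neq1 1)).
  set s := same_coef _ _ _ _; set s' := shift_coef _ _ _ _.
  by rewrite -!scalerDl mul1r -!scalerAl !mul1r [LHS]scalerA [RHS]scalerA mulrC.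
have -> : twist_exp 0 c - (a + d) * coef_deg 0 m a d c - a * d =
  - ((a + d) * n) - a * d + twist_exp 0 c by rewrite degS -/n; ring.
rewrite (qqD _ (twist_exp 0 c)) -/th degS -/n.
rewrite twist01 twist01_pred twist1S -[_ * (_ / _) * _ ^+ 2]mulrA.
rewrite hpolyS hpolySr -/n qqX4m qqX4 (qqm_even m) !qint_bracket ME ME1.
have E1 := even_step_coefX2 qq_neq0 (qq_expz_neq0 a) (qq_expz_neq0 d) (qq_expz_neq0 n)
  (qq_expz_neq0 c.+1) (qqX_neq1 1) (qq4_neq1 c).
have E2 := even_step_coef1 qq_neq0 (qq_expz_neq0 a) (qq_expz_neq0 d) (qq_expz_neq0 n)
  (qq_expz_neq0 c.+1) (qqX_neq1 1) (qq4_neq1 c).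
cbv zeta in E1, E2.
exact: combine_step E1 E2.
Qed.

(** * Straightening relations in U *)

Lemma invM_subV (R : fieldType) (q : R) : q != 0 -> q^-1 / (q - q^-1) = (q ^+ 2 - 1)^-1.
Proof. by move=> q0; rewrite -invfM; congr (_^-1); field. Qed.

(** At X = q^n, this and the next lemma give the K^-2 and, up to sign, the constant coefficient in
    the induction step of [FEcX]. *)
Lemma straighten_coefX2 (R : fieldType) (q X : R) : q != 0 -> X != 0 -> q ^+ 2 - 1 != 0 ->
  ((X * q) ^+ 2)^-1 / (q ^+ 2 - 1) +
    ((q ^+ 2 - 1)^-1 * bracket q (X * q)) * (q ^- 4 * (X ^+ 3)^-1) =
  ((q ^+ 2 - 1)^-1 * bracket q (X * q * q)) * ((X * q) ^+ 3)^-1.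
Proof.
move=> q0 X0 q2; have := subV_neq0 q0 q2.
by rewrite /bracket => h; field; rewrite q0 X0 q2 ?h.
Qed.

Lemma straighten_coef1 (R : fieldType) (q X : R) : q != 0 -> X != 0 -> q ^+ 2 - 1 != 0 ->
  ((X * q) ^+ 2)^-1 / (q ^+ 2 - 1) + ((q ^+ 2 - 1)^-1 * bracket q (X * q)) * X^-1 =
  ((q ^+ 2 - 1)^-1 * bracket q (X * q * q)) * (X * q)^-1.
Proof.
move=> q0 X0 q2; have := subV_neq0 q0 q2.
by rewrite /bracket => h; field; rewrite q0 X0 q2 ?h.
Qed.

Lemma scale_binomial_add (R : comNzRingType) (A : algType R) (x y z k u v u' v' : R) (H S : A) :
  x * k + y * u = z * u' -> x * k + y * v = z * v' ->
  x *: (H * (k *: (S - 1))) + y *: (H * (u *: S - v%:A)) = z *: (H * (u' *: S - v'%:A)).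
Proof.
move=> E1 E2; rewrite -!scalerAr scalerA !mulrBr -!scalerAr !mulr1 !scalerBr !scalerA.
by rewrite -E1 -E2 !scalerDl opprD addrACA.
Qed.

Lemma qint_div_qfact n : qint n.+1 / qfact n.+1 = (qfact n)^-1.
Proof. by rewrite qfactS invfM mulrCA mulfV ?mulr1 // qintS_neq0. Qed.

Section Straightening.
Variables (A : algType QQq) (E F K Ki : A).
Hypothesis rels : U_relations E F K Ki.

Let Ec := Echeck E Ki.

Lemma KiE : Ki * E = qq ^ (-2) *: (E * Ki).
Proof.
have [KKi KiK _ KE _] := rels.
have -> : E * Ki = qq ^+ 2 *: (Ki * E).
  by rewrite -[E * Ki]mul1r -KiK -mulrA (mulrA K) KE -scalerAl -!scalerAr -!mulrA KKi mulr1.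
by rewrite scalerA mulVf ?scale1r // expf_neq0 // qq_neq0.
Qed.

Lemma FKi : F * Ki = qq ^ (-2) *: (Ki * F).
Proof.
have [KKi KiK _ _ KF] := rels.
by rewrite -[F * Ki]mul1r -KiK -mulrA (mulrA K) KF -scalerAl -scalerAr -!mulrA KKi mulr1.
Qed.

Lemma KiEc : Ki * Ec = qq ^ (-2) *: (Ec * Ki).
Proof. by rewrite /Ec /Echeck -scalerAr mulrA KiE -!scalerAl !scalerA mulrC. Qed.

(** Multiply the commutator of E and F by q^-1 K^-1 on the right: K K^-1 = 1 makes the correction a
    polynomial in K^-2, so no positive power of K arises. *)
Lemma FEc : F * Ec = qq ^ (-2) *: (Ec * F) + (qq ^+ 2 - 1)^-1 *: (Ki ^+ 2 - 1).
Proof.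
have [KKi KiK EF _ _] := rels.
have FE : F * E = E * F - (qq - qq^-1)^-1 *: (K - Ki) by rewrite -EF opprB addrC subrK.
rewrite /Ec /Echeck -scalerAr mulrA FE mulrBl -scalerAl mulrBl KKi -!scalerAl -(mulrA E) FKi.
rewrite scalerBr scalerA (invM_subV qq_neq0) -scalerAr mulrA scalerA mulrC -scalerA.
by rewrite -expr2 -scalerN opprB.
Qed.

End Straightening.

(** * Left multiplication by t on straightened sums *)

Section ActionOfT.
Variables (A : algType QQq) (Ec F Ki : A).
Hypothesis KiEc : Ki * Ec = qq ^ (-2) *: (Ec * Ki).
Hypothesis FKi : F * Ki = qq ^ (-2) *: (Ki * F).
Hypothesis FEc : F * Ec = qq ^ (-2) *: (Ec * F) + (qq ^+ 2 - 1)^-1 *: (Ki ^+ 2 - 1).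

Let ev := horner_alg Ki.

Lemma evZ c p : ev (c *: p) = c *: ev p.
Proof. by rewrite /ev linearZ /= mulr_algl. Qed.

Lemma evB (p r : {poly QQq}) : ev (p - r) = ev p - ev r.
Proof. exact: rmorphB. Qed.

Lemma evD (p r : {poly QQq}) : ev (p + r) = ev p + ev r.
Proof. exact: rmorphD. Qed.

Lemma evM (p r : {poly QQq}) : ev (p * r) = ev p * ev r.
Proof. exact: rmorphM. Qed.

Lemma Ki2Ec : Ki ^+ 2 * Ec = qq ^- 4 *: (Ec * Ki ^+ 2).
Proof.
have KKE : Ki * (Ki * Ec) = qq ^ (-2) *: (qq ^ (-2) *: (Ec * (Ki * Ki))).
  by rewrite KiEc -scalerAr (mulrA Ki) KiEc -scalerAl -(mulrA Ec).
by rewrite expr2 -mulrA KKE scalerA -expfzDr ?qq_neq0.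
Qed.

Definition straighten_poly (n : nat) : {poly QQq} :=
  qq ^ (- (3 * n%:Z)) *: 'X^2 - (qq ^ (- n%:Z))%:P.

Lemma ev_straighten_poly n :
  ev (straighten_poly n) = qq ^ (- (3 * n%:Z)) *: Ki ^+ 2 - (qq ^ (- n%:Z))%:A.
Proof.
by rewrite /straighten_poly evB evZ /ev rmorphXn /= horner_algX horner_algC.
Qed.

(** Induction, splitting off the last factor Echeck: F passes it by [FEc], and K^-2 passes it at the
    cost of q^-4. The corrections are combinations of K^-2 and 1, which leaves two scalar
    identities. *)
Lemma FEcX n : F * Ec ^+ n.+1 =
  qq ^ (- (2 * n.+1%:Z)) *: (Ec ^+ n.+1 * F) +
  ((qq ^+ 2 - 1)^-1 * qint n.+1) *: (Ec ^+ n * ev (straighten_poly n)).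
Proof.
rewrite ev_straighten_poly.
have q3 k : qq ^ (- (3 * k%:Z)) = ((qq ^ k%:Z) ^+ 3)^-1 by rewrite qqN -(qqM 3).
have qS (k : nat) : qq ^ k.+1%:Z = qq ^ k%:Z * qq by rewrite -!exprnP exprSr.
elim: n => [|n IH].
  rewrite !expr1 expr0 mul1r FEc; congr (_ + _).
  rewrite qint_bracket /bracket expr1z mulfV ?mulr1 ?(subV_neq0 qq_neq0 (qqX_neq1 1)) //.
  by rewrite mulr0 oppr0 expr0z !scale1r.
have bE : (qq ^ (- (3 * n%:Z)) *: Ki ^+ 2 - (qq ^ (- n%:Z))%:A) * Ec =
    Ec * ((qq ^- 4 * qq ^ (- (3 * n%:Z))) *: Ki ^+ 2 - (qq ^ (- n%:Z))%:A).
  rewrite mulrBl mulrBr -!scalerAl Ki2Ec -!scalerAr mulr1 mul1r scalerA.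
  by congr (_ *: _ - _); exact: mulrC.
rewrite [Ec ^+ n.+2]exprSr mulrA IH mulrDl -!scalerAl -!mulrA FEc bE (mulrA (Ec ^+ n)) -exprSr.
rewrite mulrDr -(scalerAr (qq ^ (-2))) scalerDr scalerA -addrA; congr (_ + _).
  by rewrite -qqD; congr (qq ^ _ *: _); lia.
rewrite !q3 !qqN !qint_bracket (qqM 2) !qS.
apply: scale_binomial_add.
  exact: straighten_coefX2 qq_neq0 (qq_expz_neq0 n) (qqX_neq1 1).
exact: straighten_coef1 qq_neq0 (qq_expz_neq0 n) (qqX_neq1 1).
Qed.

Definition divided (x : A) (n : nat) : A := (qfact n)^-1 *: x ^+ n.

Lemma divided0 x : divided x 0 = 1.
Proof. by rewrite /divided qfact0 invr1 scale1r. Qed.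

Lemma dividedS x n : x * divided x n = qint n.+1 *: divided x n.+1.
Proof.
by rewrite /divided -scalerAr -exprS scalerA qint_div_qfact.
Qed.

Lemma FEcS n : F * divided Ec n.+1 =
  qq ^ (- (2 * n.+1%:Z)) *: (divided Ec n.+1 * F) +
  (qq ^+ 2 - 1)^-1 *: (divided Ec n * ev (straighten_poly n)).
Proof.
rewrite /divided -scalerAr FEcX scalerDr !scalerA -!scalerAl !scalerA.
congr (_ *: _ + _ *: _); first exact: mulrC.
by rewrite mulrCA [_^-1 * qint _]mulrC qint_div_qfact.
Qed.

Lemma KiEcX n : Ki * Ec ^+ n = qq ^ (- (2 * n%:Z)) *: (Ec ^+ n * Ki).
Proof.
elim: n => [|n IH]; first by rewrite mulr1 mul1r mulr0 oppr0 expr0z scale1r.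
rewrite exprSr (mulrA Ki) IH -scalerAl -(mulrA _ Ki) KiEc -!scalerAr scalerA !mulrA -qqD.
by congr (qq ^ _ *: _); lia.
Qed.

Lemma KiEcS n : Ki * divided Ec n = qq ^ (- (2 * n%:Z)) *: (divided Ec n * Ki).
Proof.
rewrite /divided -scalerAr -scalerAl KiEcX !scalerA.
by congr (_ *: _); exact: mulrC.
Qed.

Lemma F_ev p : F * ev p = ev (p \Po qshift) * F.
Proof.
elim/poly_ind: p => [|p c IH].
  by rewrite comp_poly0 /ev rmorph0 mulr0 mul0r.
rewrite comp_poly_MXaddC !evD !evM mulrDr mulrA IH -mulrA.
have -> : ev 'X = Ki by rewrite /ev horner_algX.
have -> : ev qshift = qq ^ (-2) *: Ki by rewrite /qshift evZ /ev horner_algX.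
by rewrite FKi /ev !horner_algC mulr_algr mulrDl mulr_algl -!scalerAr -scalerAl -mulrA.
Qed.

Definition term (a : nat) (p : {poly QQq}) (d : nat) : A :=
  divided Ec a * ev p * divided F d.

Lemma termD a p r d : term a (p + r) d = term a p d + term a r d.
Proof. by rewrite /term evD mulrDr mulrDl. Qed.

Lemma termZ a x p d : term a (x *: p) d = x *: term a p d.
Proof. by rewrite /term evZ -(scalerAr x) -(scalerAl x). Qed.

Lemma term0 a d : term a 0 d = 0.
Proof. by rewrite -(scale0r 0) termZ scale0r. Qed.

Definition lowered (a : nat) (p : {poly QQq}) (d : nat) : A :=
  if a is a'.+1 then term a' ((qq ^+ 2 - 1)^-1 *: (straighten_poly a' * p)) d else 0.

Lemma Ec_term a p d : Ec * term a p d = qint a.+1 *: term a.+1 p d.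
Proof. by rewrite /term !mulrA dividedS -!scalerAl. Qed.

Lemma Ki_term a p d : Ki * term a p d = qq ^ (- (2 * a%:Z)) *: term a ('X * p) d.
Proof.
by rewrite /term !mulrA KiEcS -!scalerAl evM [ev 'X]horner_algX !mulrA.
Qed.

Lemma F_term a p d : F * term a p d =
  (qq ^ (- (2 * a%:Z)) * qint d.+1) *: term a (p \Po qshift) d.+1 + lowered a p d.
Proof.
have F_evd r : F * (ev r * divided F d) = qint d.+1 *: (ev (r \Po qshift) * divided F d.+1).
  by rewrite mulrA F_ev -mulrA dividedS -scalerAr.
rewrite /lowered /term -mulrA; case: a => [|a].
  by rewrite addr0 divided0 !mul1r F_evd.
rewrite (mulrA F) FEcS evZ evM.
move: (divided Ec a.+1) (divided Ec a) (divided F d.+1) (divided F d) (F_evd p) => e' e f' f Ff.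
rewrite mulrDl -!scalerAl -(mulrA _ F) Ff -!scalerAr scalerA -!scalerAl -!mulrA.
by [].
Qed.

Definition square_sum (M : nat) (P : int -> int -> {poly QQq}) : A :=
  \sum_(0 <= a < M) \sum_(0 <= d < M) term a (P a d) d.

(** Every contribution lands at the same or a neighbouring index pair. Since [P] vanishes for a >= M
    or d >= M, none leaves the square, and the reindexing by [big_shift1] loses nothing. *)
Lemma mul_square_sum kappa M (P : int -> int -> {poly QQq}) :
  (forall a d : nat, (M <= a)%N || (M <= d)%N -> P a d = 0) ->
  (F + Ec + kappa *: Ki) * square_sum M.+1 P = square_sum M.+1 (act_coef kappa P).
Proof.
move=> P0.
have predE (a : nat) : a.+1%:Z - 1 = a by lia.
have succE (a : nat) : a%:Z + 1 = a.+1 by lia.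
pose U a := \sum_(0 <= d < M.+1) qint a%:Z *: term a (P (a%:Z - 1) d) d.
pose V a d := (qq ^ (- (2 * a%:Z)) * qint d%:Z) *: term a (P a (d%:Z - 1) \Po qshift) d.
pose W a := \sum_(0 <= d < M.+1) lowered a (P a d) d.
pose Z (a d : nat) := term a (qq ^ (- (2 * a%:Z)) *: (kappa *: ('X * P a d))) d.
have US : \sum_(0 <= a < M.+1) U a.+1 = \sum_(0 <= a < M.+1) U a.
  apply: big_shift1; rewrite /U big1 // => d _; first by rewrite qint0 scale0r.
  by rewrite predE P0 ?leqnn // term0 scaler0.
have VS a : \sum_(0 <= d < M.+1) V a d.+1 = \sum_(0 <= d < M.+1) V a d.
  apply: big_shift1; rewrite /V; first by rewrite qint0 mulr0 scale0r.
  by rewrite predE P0 ?leqnn ?orbT // comp_poly0 term0 scaler0.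
have WS : \sum_(0 <= a < M.+1) W a.+1 = \sum_(0 <= a < M.+1) W a.
  apply: big_shift1; rewrite /W big1 // => d _.
  by rewrite P0 ?leqnSn // /lowered mulr0 scaler0 term0.
transitivity (\sum_(0 <= a < M.+1) (U a.+1 + \sum_(0 <= d < M.+1) Z a d
    + \sum_(0 <= d < M.+1) V a d.+1 + W a)).
  rewrite /square_sum mulr_sumr; apply: eq_bigr => a _.
  rewrite mulr_sumr -!big_split; apply: eq_bigr => d _ /=.
  rewrite !mulrDl -scalerAl F_term Ec_term Ki_term /V !predE /Z !termZ.
  by rewrite -[LHS]addrA [LHS]addrC addrA !scalerA [kappa * _]mulrC.
rewrite !big_split /= US -WS -!big_split /=; apply: eq_bigr => a _.
rewrite VS -!big_split /=; apply: eq_bigr => d _.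
by rewrite /act_coef /Z /V /lowered succE !termD !termZ.
Qed.
End ActionOfT.

(** * The recursions of the defining products *)

Section TdotRecursion.
Variables (A : algType QQq) (E F Ki : A) (kappa : QQq).

Let t := t_el E F Ki kappa.

(** The new factors are those for j = -m and j = m + 1, namely t + [2m+1] and t - [2m+1]. *)
Lemma tprodS m : tprod E F Ki kappa m.+1 =
  t * (t * tprod E F Ki kappa m) - qint (2 * m%:Z + 1) ^+ 2 *: tprod E F Ki kappa m.
Proof.
set c := qint _; set p := tprod E F Ki kappa m.
(* All factors are t minus a scalar, so the last one can be moved to the front. *)
have comm_p : GRing.comm (t - c%:A) p.
  apply: commr_prod => i _; apply: commrB; apply: commr_sym.
    by apply: commrB; [exact: commr_refl | apply: commr_sym; rewrite /GRing.comm mulr_algl mulr_algr].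
  by rewrite /GRing.comm mulr_algl mulr_algr.
have -> : tprod E F Ki kappa m.+1 = (t + c%:A) * (p * (t - c%:A)).
  rewrite /tprod mulnS add2n big_nat_recl // big_nat_recr //= -/t.
  congr (_ * (_ * _)).
  - have -> : 2 * (0%:Z - m.+1%:Z + 1) - 1 = - (2 * m%:Z + 1) by lia.
    by rewrite qintN scaleNr opprK.
  - apply: eq_bigr => i _.
    by have -> : i.+1%:Z - m.+1%:Z + 1 = i%:Z - m%:Z + 1 by lia.
  - by have -> : 2 * ((2 * m).+1%:Z - m.+1%:Z + 1) - 1 = 2 * m%:Z + 1 by lia.
rewrite -comm_p mulrBl mulr_algl mulrDl mulr_algl mulrBr scalerBr -scalerAr scalerA -expr2.
by rewrite addrA subrK.
Qed.

Lemma tdot_oddE m :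
  qint (2 * m%:Z + 1) *: tdot_odd E F Ki kappa m = t * tdot_even E F Ki kappa m.
Proof.
have -> : 2 * m%:Z + 1 = (2 * m).+1 by lia.
by rewrite /tdot_odd /tdot_even scalerA qint_div_qfact -scalerAr.
Qed.
(** By [tprodS], t^2 times the product for m is the product for m + 1 plus [2m+1]^2 times that for
    m; divide by [2m+1]!. *)
Lemma tdot_evenE m :
  qint (2 * m%:Z + 2) *: tdot_even E F Ki kappa m.+1
  + qint (2 * m%:Z + 1) *: tdot_even E F Ki kappa m = t * tdot_odd E F Ki kappa m.
Proof.
have q2E : 2 * m%:Z + 2 = (2 * m).+2 by lia.
rewrite /tdot_even /tdot_odd tprodS q2E mulnS add2n [LHS]addrC !scalerA qint_div_qfact.
have -> : 2 * m%:Z + 1 = (2 * m).+1 by lia.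
rewrite scalerBr scalerA -{1}qint_div_qfact -scalerAr.
have -> : (qfact (2 * m).+1)^-1 * qint (2 * m).+1 ^+ 2 =
  qint (2 * m).+1 * (qint (2 * m).+1 / qfact (2 * m).+1) by rewrite mulrC expr2 mulrA.
by rewrite addrC subrK.
Qed.
End TdotRecursion.

(** * Induction on m and passage to the stated triple sums *)

Lemma k_poly_eq0 kappa M eps m (a d : int) :
  2 * m%:Z + eps%:Z < a + d -> k_poly kappa M eps m a d = 0.
Proof.
move=> h; rewrite /k_poly big1 // => c _.
by rewrite pX_neg ?mulr0 ?scaler0 // /coef_deg; lia.
Qed.

Section Expansion.
Variables (A : algType QQq) (E F K Ki : A) (kappa : QQq).
Hypothesis rels : U_relations E F K Ki.

Let Ec := Echeck E Ki.
Let sqsum M P := square_sum Ec F Ki M P.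

Lemma square_sumZ M x (P : int -> int -> {poly QQq}) :
  x *: sqsum M P = sqsum M (fun a d => x *: P a d).
Proof.
rewrite /sqsum /square_sum !scaler_sumr; apply: eq_bigr => a _ /=.
by rewrite !scaler_sumr; apply: eq_bigr => d _ /=; rewrite termZ.
Qed.

Lemma square_sumD M (P Q : int -> int -> {poly QQq}) :
  sqsum M P + sqsum M Q = sqsum M (fun a d => P a d + Q a d).
Proof.
rewrite /sqsum /square_sum -big_split; apply: eq_bigr => a _ /=.
by rewrite -big_split; apply: eq_bigr => d _ /=; rewrite termD.
Qed.

Lemma eq_square_sum M (P Q : int -> int -> {poly QQq}) :
  (forall a d : nat, P a d = Q a d) -> sqsum M P = sqsum M Q.
Proof.
move=> PQ; apply: eq_bigr => a _; apply: eq_bigr => d _; by rewrite PQ.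
Qed.

Lemma square_sum_one M : sqsum M.+1 (k_poly kappa M.+1 0 0) = 1.
Proof.
rewrite /sqsum /square_sum big_nat_recl // big_nat_recl //=.
rewrite !big1 => [|a _|d _].
- rewrite !addr0 /k_poly big_nat_recl //= big1 => [|c _]; last first.
    by rewrite pX_neg ?mulr0 ?scaler0 // /coef_deg; lia.
  rewrite addr0 hpoly0 mul1r /term !divided0 !mul1r mulr1.
  have -> : coef_deg 0 0 0 0 0 = 0 by [].
  have -> : twist_exp 0 0 - (0 + 0) * 0 - 0 * 0 = 0 by [].
  by rewrite expr0z scale1r pX0 rmorph1.
- by rewrite big1 // => d _; rewrite k_poly_eq0 ?term0 //; lia.
- by rewrite k_poly_eq0 ?term0 //; lia.
Qed.

Let mul_t_sqsum M (P : int -> int -> {poly QQq}) := @mul_square_sum A Ec F Ki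
  (KiEc rels) (FKi rels) (FEc rels) kappa M P.

(** One [M] serves the whole induction. The bound keeps the support a + d <= 2m + 1 off the edges of
    the square, and the factors [2m+1] and [2m+2] are nonzero, so the recursions determine both
    families. *)
Lemma tdot_square_sum m M : (2 * m + 2 <= M)%N ->
  tdot_even E F Ki kappa m = sqsum M.+1 (k_poly kappa M.+1 0 m) /\
  tdot_odd E F Ki kappa m = sqsum M.+1 (k_poly kappa M.+1 1 m).
Proof.
have even_odd n : (2 * n + 2 <= M)%N ->
    tdot_even E F Ki kappa n = sqsum M.+1 (k_poly kappa M.+1 0 n) ->
    tdot_odd E F Ki kappa n = sqsum M.+1 (k_poly kappa M.+1 1 n).
  move=> leM evenE.
  have nz : qint (2 * n%:Z + 1) != 0.
    have -> : 2 * n%:Z + 1 = (2 * n).+1 by lia.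
    exact: qintS_neq0.
  apply: (scalerI nz); rewrite tdot_oddE evenE square_sumZ.
  rewrite [LHS]mul_t_sqsum => [|a d lead]; last by rewrite k_poly_eq0 //; lia.
  apply: eq_square_sum => a d; rewrite odd_step // /coef_deg; lia.
elim: m => [|m IH] leM.
  have even0 : tdot_even E F Ki kappa 0 = sqsum M.+1 (k_poly kappa M.+1 0 0).
    by rewrite square_sum_one /tdot_even /tprod big_geq // qfact0 invr1 scale1r.
  by split=> //; exact: even_odd.
have [|evenE oddE] := IH; first by lia.
have evenSE : tdot_even E F Ki kappa m.+1 = sqsum M.+1 (k_poly kappa M.+1 0 m.+1).
  have nz : qint (2 * m%:Z + 2) != 0.
    have -> : 2 * m%:Z + 2 = (2 * m).+2 by lia.
    exact: qintS_neq0.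
  (* Adding [2m+1] tdot^(2m) to both sides produces the left side of the even recursion. *)
  apply: (scalerI nz); apply: (addIr (qint (2 * m%:Z + 1) *: tdot_even E F Ki kappa m)).
  rewrite tdot_evenE evenE oddE !square_sumZ square_sumD.
  rewrite [LHS]mul_t_sqsum => [|a d lead]; last by rewrite k_poly_eq0 //; lia.
  apply: eq_square_sum => a d; rewrite even_step // /coef_deg; lia.
by split=> //; exact: even_odd.
Qed.

(** Substitute b = a + d: the support is a triangle inside the square. *)
Lemma triangular_sum (f : nat -> nat -> A) (N M : nat) : (N <= M)%N ->
  (forall a d : nat, (N <= a + d)%N -> f a d = 0) ->
  \sum_(0 <= a < M) \sum_(0 <= d < M) f a d =
  \sum_(0 <= b < N) \sum_(0 <= a < b.+1) f a (b - a)%N.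
Proof.
move=> leNM f0.
transitivity (\sum_(0 <= b < N) \sum_(0 <= a < N | (a <= b)%N) f a (b - a)%N); last first.
  apply: eq_big_nat => b /andP[_ ltbN].
  by rewrite (big_nat_widen 0 b.+1 N) //; apply: eq_bigl => a; rewrite ltnS.
(* With a outermost, rows a >= N vanish, and in the others only d < N - a counts, that is, a <= b <
   N. *)
rewrite [RHS](exchange_big_dep_nat xpredT) //= (big_cat_nat (leq0n N) leNM) /=.
rewrite [X in _ + X]big_nat_cond [X in _ + X]big1 ?addr0 => [|a]; last first.
  rewrite andbT => /andP[leNa _]; apply: big1 => d _; apply: f0; lia.
apply: eq_big_nat => a /andP[_ ltaN].
rewrite (big_cat_nat (leq0n (N - a)%N)) /=; last by lia.
rewrite [X in _ + X]big_nat_cond [X in _ + X]big1 ?addr0 => [|d]; last first.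
  rewrite andbT => /andP[leNd _]; apply: f0; lia.
transitivity (\sum_(a <= b < N) f a (b - a)%N); last first.
  by rewrite (big_nat_widenl a 0 N).
have := big_addn (op := +%R) 0 N a xpredT (fun b => f a (b - a)%N); rewrite add0n => ->.
apply: eq_bigr => d _; by rewrite addnK.
Qed.

Lemma hpoly_ev m c : horner_alg Ki (hpoly m c) = hbrace Ki (1 - m%:Z) c.
Proof.
rewrite /hpoly /hbrace rmorph_prod; apply: eq_bigr => i _ /=.
rewrite evZ evB evZ rmorphXn /= horner_algX horner_algC.
by have -> : 4 * (1 - m%:Z) + 4 * i.+1%:Z - 4 = 4 * i.+1%:Z - 4 * m%:Z by lia.
Qed.

Lemma pX_ev n : horner_alg Ki (pX kappa n) = p_div kappa n *: Kpow K Ki (- n).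
Proof.
rewrite /pX evZ rmorphXn /= horner_algX.
by case: n => [[|n]|n] //=; rewrite !scale0r.
Qed.

Lemma term_k_poly M eps m (a d : nat) : (m < M)%N -> (eps <= 1)%N ->
  term Ec F Ki a (k_poly kappa M eps m a d) d =
  \sum_(0 <= c < m.+1)
    (qq ^ (twist_exp eps c - (a%:Z + d%:Z) * coef_deg eps m a d c - a%:Z * d%:Z) *
     p_div kappa (coef_deg eps m a d c)) *:
    (Echeck_div E Ki a * hbrace Ki (1 - m%:Z) c *
     Kpow K Ki (- coef_deg eps m a d c) * F_div F d).
Proof.
(* For c > m the degree is at most [eps] - 2 < 0, so the sum stops at c = m. *)
move=> ltmM eps1; rewrite /k_poly (big_cat_nat (leq0n m.+1) ltmM) /=.
rewrite [X in _ + X]big_nat_cond [X in _ + X]big1 ?addr0 => [|c]; last first.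
  rewrite andbT => /andP[ltmc _].
  by rewrite pX_neg ?mulr0 ?scaler0 // /coef_deg; lia.
rewrite /term rmorph_sum mulr_sumr mulr_suml; apply: eq_bigr => c _ /=.
rewrite evZ evM hpoly_ev pX_ev.
set x := qq ^ _; set y := p_div _ _; set e := divided Ec a; set f := divided F d.
rewrite -(scalerAr y) scalerA -(scalerAr (x * y)) -(scalerAl (x * y)) (mulrA e).
by [].
Qed.
End Expansion.

(* Identity in U, stated (equivalently, by the universal property of U) in
   every Q(q)-algebra A with elements E, F, K, K^{-1} satisfying the relations. *)
Theorem theorem3p3 (A : algType QQq) (E F K Ki : A) (l : int) :
  U_relations E F K Ki ->
  let kappa := qint (2 * l) in
  forall m : nat,
    tdot_even E F Ki kappa m =
      \sum_(0 <= b < (2 * m).+1) \sum_(0 <= a < b.+1) \sum_(0 <= c < m.+1)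
        (qq ^ (('C(2 * c, 2))%:Z - b%:Z * (2 * m%:Z - b%:Z - 2 * c%:Z)
                - a%:Z * (b%:Z - a%:Z))
         * p_div kappa (2 * m%:Z - b%:Z - 2 * c%:Z)) *:
        (Echeck_div E Ki a * hbrace Ki (1 - m%:Z) c
         * Kpow K Ki (b%:Z - 2 * m%:Z + 2 * c%:Z) * F_div F (b - a))
 /\ tdot_odd E F Ki kappa m =
      \sum_(0 <= b < (2 * m).+2) \sum_(0 <= a < b.+1) \sum_(0 <= c < m.+1)
        (qq ^ (('C(2 * c, 2))%:Z - 2 * c%:Z
                - b%:Z * (2 * m%:Z - b%:Z - 2 * c%:Z + 1)
                - a%:Z * (b%:Z - a%:Z))
         * p_div kappa (2 * m%:Z - b%:Z - 2 * c%:Z + 1)) *: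
        (Echeck_div E Ki a * hbrace Ki (1 - m%:Z) c
         * Kpow K Ki (b%:Z - 2 * m%:Z + 2 * c%:Z - 1) * F_div F (b - a)).
Proof.
move=> rels kappa m; move: kappa => kappa.
have [-> ->] := tdot_square_sum kappa rels (leqnn (2 * m + 2)%N).
split.
  (* Coefficients with a + d > 2m vanish, so b runs up to 2m. *)
  rewrite /square_sum (triangular_sum (N := (2 * m).+1)); last 2 first.
  - by lia.
  - by move=> a d lead; rewrite k_poly_eq0 ?term0 //; lia.
  apply: eq_big_nat => b _; apply: eq_big_nat => a /andP[_ leab].
  rewrite (term_k_poly E F K) //; last by lia.
  have dE : (b - a)%N%:Z = b%:Z - a%:Z by lia.
  apply: eq_bigr => c _; rewrite dE.
  have -> : coef_deg 0 m a (b%:Z - a%:Z) c = 2 * m%:Z - b%:Z - 2 * c%:Z.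
    by rewrite /coef_deg; ring.
  set n := 2 * m%:Z - b%:Z - 2 * c%:Z.
  have -> : b%:Z - 2 * m%:Z + 2 * c%:Z = - n by rewrite /n; ring.
  have -> : twist_exp 0 c - (a%:Z + (b%:Z - a%:Z)) * n - a%:Z * (b%:Z - a%:Z) =
    'C(2 * c, 2)%:Z - b%:Z * n - a%:Z * (b%:Z - a%:Z).
    by rewrite /twist_exp mul0n; ring.
  by [].
rewrite /square_sum (triangular_sum (N := (2 * m).+2)); last 2 first.
- by lia.
- by move=> a d lead; rewrite k_poly_eq0 ?term0 //; lia.
apply: eq_big_nat => b _; apply: eq_big_nat => a /andP[_ leab].
rewrite (term_k_poly E F K) //; last by lia.
have dE : (b - a)%N%:Z = b%:Z - a%:Z by lia.
apply: eq_bigr => c _; rewrite dE.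
have -> : coef_deg 1 m a (b%:Z - a%:Z) c = 2 * m%:Z - b%:Z - 2 * c%:Z + 1.
  by rewrite /coef_deg; ring.
set n := 2 * m%:Z - b%:Z - 2 * c%:Z + 1.
have -> : b%:Z - 2 * m%:Z + 2 * c%:Z - 1 = - n by rewrite /n; ring.
have -> : twist_exp 1 c - (a%:Z + (b%:Z - a%:Z)) * n - a%:Z * (b%:Z - a%:Z) =
  'C(2 * c, 2)%:Z - 2 * c%:Z - b%:Z * n - a%:Z * (b%:Z - a%:Z).
  by rewrite /twist_exp mul1n; ring.
by [].
Qed.
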